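(* Let $n=m^2$ for a positive integer $m$. The function $\mathtt{notPERM}_n$ is computed by an NUOBDD of width 2.
   Context: For $n=m^2$, inputs $\sigma\in\{0,1\}^n$ have bits indexed $x_{1,1},\dots,x_{1,m},x_{2,1},\dots,x_{m,m}$ and define the $m\times m$ 0-1 matrix $A(\sigma)$ with $(i,j)$ entry $x_{i,j}$. $\mathtt{notPERM}_n(\sigma)=0$ if $A(\sigma)$ is a permutation matrix (exactly one 1 in each row and each column), and $1$ otherwise. A unitary OBDD (UOBDD) of width $d$ on $n$ variables is $(Q,|\psi^0\rangle,T,Q_{acc})$: $Q=\{q_1,\dots,q_d\}$ indexes an orthonormal basis of $\mathbb{C}^d$, $|\psi^0\rangle$ a unit vector, $Q_{acc}\subseteq Q$, $T=((i_j,U_j(0),U_j(1)))_{j=1}^n$ with $(i_1,\dots,i_n)$ a permutation of the variable indices and $U_j(b)$ unitary $d\times d$ matrices. On input $\sigma$ the final state is $|\psi^n\rangle=U_n(\sigma_{i_n})\cdots U_1(\sigma_{i_1})|\psi^0\rangle$ and the acceptance probability is $\|P_{acc}|\psi^n\rangle\|^2$ with $P_{acc}$ the projection onto the span of accepting basis states. An NUOBDD computes $f$ if for all $\sigma$: $f(\sigma)=1$ iff the acceptance probability is nonzero. *)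

(* Defs.v *)
From mathcomp Require Export all_boot all_order all_fingroup all_algebra.
From mathcomp Require Export complex.
From mathcomp Require Export reals.
Set Implicit Arguments.
Unset Strict Implicit.
Unset Printing Implicit Defensive.

Import Order.TTheory GRing.Theory Num.Theory.
Local Open Scope ring_scope.
Local Open Scope complex_scope.

Lemma bit_index_subproof (m : nat) (i j : 'I_m) : (i * m + j < m ^ 2)%N.
Proof.
apply: (@leq_trans (i * m + m)%N); first by rewrite ltn_add2l.
by rewrite -mulSnr -mulnn leq_mul2r ltn_ord orbT.
Qed.

(* Row-major numbering: x_{1,1}, ..., x_{1,m}, x_{2,1}, ..., x_{m,m}.         *)
Definition bit_index (m : nat) (i j : 'I_m) : 'I_(m ^ 2) :=
  Ordinal (bit_index_subproof i j).

Definition input_matrix (m : nat) (s : (m ^ 2).-tuple bool) : 'M[nat]_m :=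
  \matrix_(i, j) nat_of_bool (tnth s (bit_index i j)).

(* For a 0-1 matrix this is equivalent to is_perm_mx: see is_perm_matrixE.    *)
Definition is_perm_matrix (m : nat) (A : 'M[nat]_m) : bool :=
  [forall i, #|[set j | A i j == 1%N]| == 1%N] &&
  [forall j, #|[set i | A i j == 1%N]| == 1%N].

Definition notPERM (m : nat) (s : (m ^ 2).-tuple bool) : bool :=
  ~~ is_perm_matrix (input_matrix s).

Lemma is_perm_matrixE (m : nat) (s : (m ^ 2).-tuple bool) :
  is_perm_matrix (input_matrix s) = is_perm_mx (input_matrix s).
Proof.
set A := input_matrix s; apply/idP/is_perm_mxP => [|[p ->]].
  case/andP=> /forallP row1 /forallP col1.
  have ex1 i : exists j, [set k | A i k == 1%N] == [set j].
    by have /cards1P[j ->] := row1 i; exists j.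
  pose f i := xchoose (ex1 i).
  have fP i j : (A i j == 1%N) = (j == f i).
    by have /eqP/setP/(_ j) := xchooseP (ex1 i); rewrite !inE.
  have f_inj : injective f.
    move=> i1 i2 eqf; have /cards1P[i /setP col] := col1 (f i1).
    have := col i1; have := col i2.
    by rewrite !inE !fP eqxx eqf eqxx => /esym/eqP -> /esym/eqP ->.
  exists (perm f_inj); apply/matrixP=> i j; have := fP i j.
  rewrite /A !mxE permE [f i == j]eq_sym.
  by case: (tnth _ _); rewrite /= => <-.
apply/andP; split; apply/forallP=> i; apply/cards1P.
  exists (p i); apply/setP=> j; rewrite !inE !mxE [p i == j]eq_sym.
  by case: (j == p i).
exists (p^-1%g i); apply/setP=> j; rewrite !inE !mxE.
by rewrite (canF_eq (permK p)); case: (j == _).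
Qed.

Definition sqnorm (R : realType) (d : nat) (v : 'cV[R[i]]_d) : R[i] :=
  \sum_(q < d) `|v q 0| ^+ 2.

(* The basis q_1, ..., q_d is the standard basis of column vectors, indexed   *)
(* by 'I_d.  At step j the program reads the variable uobdd_order j and       *)
(* applies uobdd_trans j b, where b is the value read.                        *)
Record uobdd (R : realType) (n d : nat) := UOBDD {
  uobdd_init : 'cV[R[i]]_d;
  uobdd_order : {perm 'I_n};
  uobdd_trans : 'I_n -> bool -> 'M[R[i]]_d;
  uobdd_acc : {set 'I_d};
  uobdd_init_unit : sqnorm uobdd_init = 1;
  uobdd_trans_unitary : forall j b, uobdd_trans j b \is unitarymx
}.

(* enum 'I_n is increasing, so the step 0 matrix is applied first.            *)
Definition final_state (R : realType) (n d : nat) (B : uobdd R n d)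
    (s : n.-tuple bool) : 'cV[R[i]]_d :=
  foldl (fun psi j => uobdd_trans B j (tnth s (uobdd_order B j)) *m psi)
    (uobdd_init B) (enum 'I_n).

Definition acc_proj (R : realType) (d : nat) (acc : {set 'I_d}) : 'M[R[i]]_d :=
  diag_mx (\row_q (q \in acc)%:R).

Definition acc_prob (R : realType) (n d : nat) (B : uobdd R n d)
    (s : n.-tuple bool) : R[i] :=
  sqnorm (acc_proj R (uobdd_acc B) *m final_state B s).

(* An NUOBDD is a UOBDD with this nondeterministic acceptance criterion.      *)
Definition nuobdd_computes (R : realType) (n d : nat) (B : uobdd R n d)
    (f : n.-tuple bool -> bool) : Prop :=
  forall s, f s = true <-> acc_prob B s <> 0.

(* Main.v *)
(* Every step applies a power of the rotation [rot] by the angle arctan(4/3),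
   so only the total exponent matters.  Giving the entry (i, j) the weight
   b ^ i + b ^ (m + j) with b = m + 1, the total weight of the 1 entries is
   the base b numeral whose 2m digits are the row and column sums, all less
   than b; it equals the numeral 1...1 exactly for permutation matrices.
   Starting from the first basis vector rotated back by that numeral, the final
   state has a zero second coordinate iff the total rotation is trivial,
   because no nontrivial power of [rot] has a zero entry: the angle is not a
   rational multiple of pi, as seen by reducing 5 * rot modulo 5. *)
Require Import Defs.
From mathcomp Require Import ring.

Import Order.TTheory GRing.Theory Num.Theory.
Local Open Scope ring_scope.
Local Open Scope complex_scope.
Local Open Scope sesquilinear_scope.

(** Reduction modulo [b] isolates the lowest digit; cancelling it and dividing by [b] leaves
    numerals with one digit fewer. *)
Lemma base_digits_inj (b n : nat) (f g : 'I_n -> nat) :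
    (forall k, f k < b)%N -> (forall k, g k < b)%N ->
    (\sum_(k < n) f k * b ^ k = \sum_(k < n) g k * b ^ k)%N ->
  f =1 g.
Proof.
elim: n f g => [|n IHn] f g ltf ltg; first by move=> _ [].
have split_digit (h : 'I_n.+1 -> nat) :
    (\sum_(k < n.+1) h k * b ^ k
     = (\sum_(k < n) h (lift ord0 k) * b ^ k) * b + h ord0)%N.
  rewrite big_ord_recl muln1 addnC big_distrl; congr (_ + _)%N.
  by apply: eq_bigr => k _; rewrite /= /bump /= add1n expnSr mulnA.
rewrite !split_digit => eq_fg.
have eq0 : f ord0 = g ord0.
  by have /(congr1 (modn^~ b)) := eq_fg; rewrite !modnMDl !modn_small.
have b_gt0 : (0 < b)%N by apply: leq_ltn_trans (ltf ord0).
have /IHn eqS : (\sum_(k < n) f (lift ord0 k) * b ^ k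
                 = \sum_(k < n) g (lift ord0 k) * b ^ k)%N.
  by move: eq_fg; rewrite eq0 => /addIn/eqP; rewrite eqn_pmul2r // => /eqP.
by move=> k; case: (unliftP ord0 k) => [j|] -> //; apply: eqS.
Qed.

(** In row-major numbering [k %/ m] is the row and [k %% m] the column of cell [k]. *)
Definition cell_weight {m : nat} (k : 'I_(m ^ 2)) : nat :=
  (m.+1 ^ (k %/ m) + m.+1 ^ (m + k %% m))%N.

Definition input_weight {m : nat} (s : (m ^ 2).-tuple bool) : nat :=
  (\sum_k tnth s k * cell_weight k)%N.

Definition perm_weight (m : nat) : nat := (\sum_(k < m + m) m.+1 ^ k)%N.

Lemma bit_index_bij (m : nat) :
  bijective (fun ij : 'I_m * 'I_m => bit_index ij.1 ij.2).
Proof.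
apply: inj_card_bij; last by rewrite card_prod !card_ord mulnn.
move=> [i j] [i' j'] /(congr1 val) /= eq_ij.
have m_gt0 : (0 < m)%N by apply: leq_ltn_trans (ltn_ord i).
congr (_, _); apply: val_inj.
  have /(congr1 (divn^~ m)) := eq_ij.
  by rewrite !divnMDl // !divn_small // !addn0.
by have /(congr1 (modn^~ m)) := eq_ij; rewrite !modnMDl !modn_small.
Qed.

Lemma input_weightE (m : nat) (s : (m ^ 2).-tuple bool) :
  input_weight s =
    (\sum_i (\sum_j input_matrix s i j) * m.+1 ^ i
     + \sum_j (\sum_i input_matrix s i j) * m.+1 ^ (m + j))%N.
Proof.
rewrite /input_weight (reindex _ (onW_bij _ (bit_index_bij m))) /=.
rewrite -(pair_bigA _ (fun i j => tnth s (bit_index i j)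
                                  * cell_weight (bit_index i j))%N) /=.
under [X in (_ + X)%N]eq_bigr do rewrite big_distrl.
rewrite [X in (_ + X)%N]exchange_big -big_split; apply: eq_bigr => i _ /=.
rewrite big_distrl -big_split; apply: eq_bigr => j _ /=.
have m_gt0 : (0 < m)%N by apply: leq_ltn_trans (ltn_ord i).
rewrite /cell_weight /= divnMDl // divn_small // addn0 modnMDl modn_small //.
by rewrite mulnDr mxE.
Qed.

Lemma notPERME (m : nat) (s : (m ^ 2).-tuple bool) :
  notPERM s = (input_weight s != perm_weight m).
Proof.
set A := input_matrix s.
have cardE (P : 'I_m -> bool) : #|[set k | P k]| = (\sum_k P k)%N.
  by rewrite -sum1_card big_mkcond; apply: eq_bigr => k _; rewrite inE; case: P.
have A_bool i j : nat_of_bool (A i j == 1%N) = A i j.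
  by rewrite mxE; case: (tnth _ _).
have rowE i : #|[set j | A i j == 1%N]| = (\sum_j A i j)%N.
  by rewrite cardE; apply: eq_bigr.
have colE j : #|[set i | A i j == 1%N]| = (\sum_i A i j)%N.
  by rewrite cardE; apply: eq_bigr.
rewrite /notPERM; congr (~~ _).
(* The digits of the weight: row sums in the low [m] places, column sums in the high ones. *)
pose line_sum (k : 'I_(m + m)) : nat :=
  match split k with inl i => \sum_j A i j | inr j => \sum_i A i j end.
have weightE : input_weight s = (\sum_(k < m + m) line_sum k * m.+1 ^ k)%N.
  rewrite input_weightE big_split_ord; congr (_ + _)%N; apply: eq_bigr => k _ /=.
    by rewrite /line_sum (unsplitK (inl _ k)).
  by rewrite /line_sum (unsplitK (inr _ k)).
rewrite weightE /perm_weight; apply/idP/eqP.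
  case/andP=> /forallP row1 /forallP col1; apply: eq_bigr => k _.
  rewrite /line_sum; case: split => i.
    by rewrite -rowE (eqP (row1 i)) mul1n.
  by rewrite -colE (eqP (col1 i)) mul1n.
move=> eq_sum; have line1 : line_sum =1 fun=> 1%N.
  apply: (@base_digits_inj m.+1) => [k|k|].
  - rewrite /line_sum ltnS; case: split => i.
      by rewrite -rowE -[leqRHS]card_ord max_card.
    by rewrite -colE -[leqRHS]card_ord max_card.
  (* The digit 1 is below the base only if [0 < m], which the index [i] in ['I_m] witnesses. *)
  - by rewrite ltnS; case: (split k) => i; apply: leq_ltn_trans (ltn_ord i).
  - by rewrite eq_sum; apply: eq_bigr => k _; rewrite mul1n.
apply/andP; split; apply/forallP => i; apply/eqP.
  by rewrite rowE -(line1 (lshift m i)) /line_sum (unsplitK (inl _ i)).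
by rewrite colE -(line1 (rshift m i)) /line_sum (unsplitK (inr _ i)).
Qed.

(** Five times the rotation with cosine 3/5 and sine 4/5, kept integral so that it can be reduced
    modulo 5. *)
Definition rot_num : 'M[int]_2 :=
  \matrix_(i, j) (if i == j then 3 else if i == 0 then - 4 else 4).

(** The trace is 6 and the determinant 25, so modulo 5 the matrix is idempotent by Cayley-Hamilton.
    Its positive powers thus all reduce to itself, and none of its entries is divisible by 5. *)
Lemma rot_num_exp_neq0 (k : nat) (i j : 'I_2) : (rot_num ^+ k.+1) i j != 0.
Proof.
pose P5 : 'M['F_5]_2 := map_mx intr rot_num.
have P5_idem : P5 * P5 = P5.
  apply/matrixP => -[[|[|?]] ?] [[|[|?]] ?] //;
    by rewrite !mxE !big_ord_recl big_ord0 !mxE; apply/val_inj.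
have P5_exp : P5 ^+ k.+1 = P5.
  by elim: k => // k IHk; rewrite exprS IHk.
have P5_neq0 : P5 i j != 0.
  by rewrite !mxE; case: i j => -[|[|?]] // ? [[|[|?]] ?].
apply: contraNneq P5_neq0 => Pij0.
by rewrite -P5_exp -rmorphXn mxE Pij0.
Qed.

Section Rotation.
Variable R : realType.
Local Notation C := R[i].

Definition rot : 'M[C]_2 := 5^-1 *: map_mx intr rot_num.

Lemma rot_exp_neq0 (k : nat) (i j : 'I_2) : (rot ^+ k.+1) i j != 0.
Proof.
rewrite exprZn -rmorphXn !mxE mulf_neq0 ?expf_neq0 ?invr_eq0 ?pnatr_eq0 //.
by rewrite intr_eq0 rot_num_exp_neq0.
Qed.

Lemma rot_unitary : rot \is unitarymx.
Proof.
(* The entries are real, so unitarity comes down to 9 + 16 = 25. *)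
have conj_rot : rot^t* = rot^T.
  by apply/matrixP => i j; rewrite !mxE rmorphM fmorphV /= rmorph_nat rmorph_int.
apply/unitarymxP; rewrite conj_rot.
apply/matrixP => -[[|[|?]] ?] [[|[|?]] ?] //;
  by rewrite !mxE !big_ord_recl big_ord0 !mxE /=; field.
Qed.

Lemma rot_exp_unitary (k : nat) : rot ^+ k \is unitarymx.
Proof.
elim: k => [|k IHk]; first by apply/unitarymxP; rewrite trmx1 map_mx1 mulmx1.
by rewrite exprS mul_unitarymx ?rot_unitary.
Qed.

Lemma sqnorm_unitary_col (d : nat) (U : 'M[C]_d) (j : 'I_d) :
  U \is unitarymx -> sqnorm (col j U) = 1.
Proof.
rewrite -trmxC_unitary => /unitarymxP; rewrite trmxCK.
move=> /matrixP/(_ j j); rewrite !mxE eqxx mulr1n => <-.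
by apply: eq_bigr => q _; rewrite !mxE normCKC.
Qed.

(** Unitarity cancels the smaller power. If [a] and [b] differ, a positive power of [rot] or its
    adjoint remains, with no zero entry. *)
Lemma rot_exp_mul_trmxC (a b : nat) :
  ((rot ^+ a *m (rot ^+ b)^t*) 1 0 == 0) = (a == b).
Proof.
have cancel k : rot ^+ k *m (rot ^+ k)^t* = 1%:M.
  exact/unitarymxP/rot_exp_unitary.
case: (ltngtP a b) => [lt_ab|lt_ba|->]; last by rewrite cancel mxE eqxx.
  rewrite -(subnK lt_ab) addnS -addSn exprD trmx_mul map_mxM mulmxA cancel mul1mx.
  by rewrite !mxE conjC_eq0 (negPf (rot_exp_neq0 _ _ _)).
rewrite -(subnK lt_ba) addnS -addSn exprD -mulmxA cancel mulmx1.
by rewrite (negPf (rot_exp_neq0 _ _ _)).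
Qed.

Section Program.
Variables (n : nat) (w : 'I_n -> nat) (W : nat).

Lemma rot_uobdd_init_unit : sqnorm (col 0 ((rot ^+ W)^t*)) = 1.
Proof. by apply: sqnorm_unitary_col; rewrite trmxC_unitary rot_exp_unitary. Qed.

(** The initial vector and the transitions are inferred from the two proofs: step [j] applies
    [rot ^+ (b * w j)], the identity on a 0 bit. *)
Definition rot_uobdd : uobdd R n 2 :=
  UOBDD 1%g [set 1] rot_uobdd_init_unit
    (fun j b => rot_exp_unitary (b * w j)%N).

Lemma final_state_rot_uobdd (s : n.-tuple bool) :
  final_state rot_uobdd s =
    col 0 (rot ^+ (\sum_k tnth s k * w k) *m (rot ^+ W)^t*).
Proof.
(* Taking the column inside the product exposes the initial vector, which the induction on the list
   of steps generalizes. *)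
rewrite colE -mulmxA -colE /final_state -[index_enum _]enumT /=.
elim: (enum _) (col _ _) => [|k r IHr] v /=; first by rewrite big_nil mul1mx.
by rewrite IHr perm1 big_cons addnC exprD mulmxA.
Qed.

Lemma acc_prob_rot_uobdd (s : n.-tuple bool) :
  (acc_prob rot_uobdd s == 0) = (\sum_k tnth s k * w k == W)%N.
Proof.
rewrite -rot_exp_mul_trmxC /acc_prob final_state_rot_uobdd /sqnorm.
(* The projection kills coordinate 0, so only the squared modulus of coordinate 1 survives. *)
rewrite !big_ord_recl big_ord0 mul_diag_mx !mxE !inE /=.
rewrite mul0r normr0 expr0n mul1r add0r addr0 sqrf_eq0 normr_eq0.
by have -> : lift ord0 ord0 = 1 :> 'I_2 by apply: val_inj.
Qed.

End Program.
End Rotation.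

Theorem theorem2 (R : realType) (m : nat) (hm : (0 < m)%N) :
  exists B : uobdd R (m ^ 2) 2, nuobdd_computes B (@notPERM m).
Proof.
exists (rot_uobdd R _ cell_weight (perm_weight m)) => s.
rewrite notPERME -(acc_prob_rot_uobdd R _ cell_weight).
by split=> /eqP.
Qed.
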